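(* Let $X$ be a compact metric space, let $H\subset C(X)$ be a vector subspace which is total outside its zeros, and let $\mathcal{F}$ be a cone of upper semicontinuous functions on $X$ which is $H$-admissible. Fix $x\in X$ and assume that there exists $C_x>0$ such that for each $h\in H$ there exists $u\in\mathcal{F}$ with $u\le h$ and $$u(x)\ge -C_x|h|_\infty .$$ Then for each non-decreasing sequence $h_i\in H$ with pointwise limit $h_i\nearrow h_\infty$, we have $S_x(h_\infty)=I_x(h_\infty)$.
   Context: $C(X)$ is the space of real-valued continuous functions on $X$, $|\cdot|_\infty$ is the sup norm. Upper semicontinuous functions may take the value $-\infty$. A cone of functions is a set closed under addition and multiplication by positive scalars. For a vector space $H\subset C(X)$, let $Z_H=\{x\in X : h(x)=0 \text{ for all } h\in H\}$ and let $E:C_c(X\setminus Z_H)\to C(X)$ denote extension by zero. $H$ is total outside its zeros if for each $\varphi\in E(C_c(X\setminus Z_H))$ there exists a decreasing sequence $h_i\in H$ with $h_i\searrow\varphi$ pointwise. $\mathcal{F}$ is $H$-admissible if each element of $H$ has a minorant in $\mathcal{F}$, and for each $u\in\mathcal{F}$ there exists a decreasing sequence $h_i\in H$ with $h_i\searrow u$ pointwise. $J_x^{\mathcal{F}}$ is the set of Jensen measures for $\mathcal{F}$ with barycenter $x$, i.e. (compactly supported) positive measures $\mu$ on $X$ with $u(x)\le\int u\,d\mu$ for all $u\in\mathcal{F}$. For a Borel function $g$ on $X$, $$S_x(g)=\sup\{u(x): u\in\mathcal{F},\ u\le g\}$$ if some $u\in\mathcal{F}$ satisfies $u\le g$, and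 $S_x(g)=-\infty$ otherwise; and $$I_x(g)=\inf\Big\{\int g\,d\mu : \mu\in J_x^{\mathcal{F}}\Big\}.$$ *)

(* Defs.v *)
From HB Require Import structures.
From mathcomp Require Import all_boot all_order all_algebra.
From mathcomp Require Import all_classical all_reals all_analysis.

Set Implicit Arguments.
Unset Strict Implicit.
Unset Printing Implicit Defensive.

Import Order.TTheory GRing.Theory Num.Theory.
Import numFieldNormedType.Exports.

Local Open Scope classical_set_scope.
Local Open Scope ring_scope.

(* Measurable types are required to be pointed, metric spaces are not. The
   choice of the point is immaterial to everything below. *)
Definition pointed_at (T : Type) (t : T) : Type := T.

HB.instance Definition _ (T : choiceType) (t : T) := Choice.on (pointed_at t).
HB.instance Definition _ (T : choiceType) (t : T) :=
  isPointed.Build (pointed_at t) t.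

Definition borel (X : topologicalType) (x : X) :=
  g_sigma_algebraType (@open X : set (set (pointed_at x))).

Section continuous_functions.
Context {R : realType}.

Definition sup_norm (T : Type) (h : T -> R) : R := sup (range (fun y => `|h y|)).

Definition Cc (Y : topologicalType) : set (Y -> R) :=
  [set phi | continuous phi /\ compact (closure [set y | phi y != 0])].

Definition decreases_to (T : Type) (h : (T -> R)^nat) (g : T -> \bar R) :=
  forall y, nonincreasing_seq (h^~ y) /\ (h i y)%:E @[i --> \oo] --> g y.

Definition increases_to (T : Type) (h : (T -> R)^nat) (g : T -> \bar R) :=
  forall y, nondecreasing_seq (h^~ y) /\ (h i y)%:E @[i --> \oo] --> g y.

Definition subspace_of_C (X : topologicalType) (H : set (X -> R)) :=
  [/\ forall h, H h -> continuous h, H 0 &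
      forall (a : R) (f g : X -> R), H f -> H g -> H (a *: f + g)].

Definition zeros (T : Type) (H : set (T -> R)) : set T :=
  [set y | forall h, H h -> h y = 0].

(* 'valL_ 0 is extension by zero from the subtype ~` zeros H, which carries the
   subspace topology. *)
Definition total_outside_zeros (X : topologicalType) (H : set (X -> R)) :=
  forall phi : ~` zeros H -> R, Cc phi ->
    exists2 h : (X -> R)^nat, (forall i, H (h i)) &
      decreases_to h (EFin \o 'valL_ 0 phi).

End continuous_functions.

Section cones.
Context {R : realType}.
Local Open Scope ereal_scope.

(* The value -oo is allowed, +oo is not. *)
Definition usc (X : topologicalType) (u : X -> \bar R) :=
  (forall y, u y < +oo) /\ lower_semicontinuous (fun y => - u y).

Definition usc_cone (X : topologicalType) (F : set (X -> \bar R)) :=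
  [/\ forall u, F u -> usc u,
      forall u v, F u -> F v -> F (fun y => u y + v y) &
      forall (c : R) u, (0 < c)%R -> F u -> F (fun y => c%:E * u y)].

Definition admissible (T : Type) (H : set (T -> R)) (F : set (T -> \bar R)) :=
  (forall h, H h -> exists2 u, F u & forall y, u y <= (h y)%:E) /\
  (forall u, F u -> exists2 h : (T -> R)^nat, (forall i, H (h i)) &
     decreases_to h u).

(* Positive measures are Radon, hence finite when compactly supported. *)
Definition jensen (X : topologicalType) (F : set (X -> \bar R)) (x : X) :=
  [set mu : {finite_measure set (borel x) -> \bar R} |
            (exists2 K : set X, compact K & mu (~` K) = 0) /\
            forall u, F u -> u x <= \int[mu]_y u y].
#[global] Arguments jensen {X} F x _.

(* ereal_sup set0 = -oo, which is the convention when F has no minorant of g. *)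
Definition S_ (T : Type) (F : set (T -> \bar R)) (x : T) (g : T -> \bar R) :
    \bar R :=
  ereal_sup [set u x | u in [set u | F u /\ forall y, u y <= g y]].

Definition I_ (X : topologicalType) (F : set (X -> \bar R)) (x : X)
    (g : X -> \bar R) : \bar R :=
  ereal_inf [set \int[mu]_y g y | mu in jensen F x].

End cones.

(* Main.v *)
(** The inequality S <= I is integration of u <= h_oo against a Jensen measure.
    For the converse let s = S_x(h_oo), assumed finite. Totality lets one split
    any h in H, up to a small error, as a difference of nonnegative elements of
    H, so the hypothesis on C_x improves to: if h >= -b, then h has a minorant u
    in F with u(x) >= - C_x b - e. Hence, writing any u in F as a decreasing
    limit of elements of H and using Dini's theorem, u <= t h_j + a with
    t, a >= 0 implies u(x) <= t s + C_x a. This says exactly that the convex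
    cone of the constraints L(g) >= u(x) - t s - C_x a, for u <= g + t h_j + a,
    is consistent, so by a Hahn-Banach argument some linear functional L on C(X)
    satisfies all of them: it is positive, L(h_j) <= s for all j, and
    L(g) >= u(x) whenever u <= g. The measure representing L (Riesz) is a Jensen
    measure, and by monotone convergence the integral of h_oo is at most s; no
    weak compactness of the set of Jensen measures is needed. *)

Require Import Defs.
From HB Require Import structures.
From mathcomp Require Import all_boot all_order all_algebra.
From mathcomp Require Import all_classical all_reals all_analysis.
From mathcomp Require Import measurable_realfun ring lra.

Set Implicit Arguments.
Unset Strict Implicit.
Unset Printing Implicit Defensive.

Import Order.TTheory GRing.Theory Num.Theory.
Import numFieldNormedType.Exports.

Local Open Scope classical_set_scope.
Local Open Scope ring_scope.

(** * Extension of functionals dominated from below by a convex cone *)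

Section sandwich.
Context {R : realType} {V : lmodType R}.
Implicit Types (P Q : set (V * R)) (v w : V).

(** A pair [(v, c)] is read as the constraint [c <= L v] on an unknown functional [L]; the last
    clause says that the constraints are consistent. *)
Definition proper_cone P :=
  [/\ forall v w c d, P (v, c) -> P (w, d) -> P (v + w, c + d),
      forall r v c, 0 < r -> P (v, c) -> P (r *: v, r * c) &
      forall c, P (0, c) -> c <= 0].

Lemma maximal_proper_cone P : proper_cone P ->
  exists Q, [/\ P `<=` Q, proper_cone Q &
    forall B, Q `<=` B -> proper_cone B -> B `<=` Q].
Proof.
move=> pP.
(* Zorn's lemma is applied to the sets whose union with [P] is proper, so that the empty chain,
   whose union is empty, causes no trouble. *)
have [|A [pA maxA]] := @Zorn_bigcup _ [set A | proper_cone (A `|` P)].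
  move=> /= F FP Ftot.
  have common p q :
      (\bigcup_(A in F) A `|` P) p -> (\bigcup_(A in F) A `|` P) q ->
      exists A, [/\ proper_cone (A `|` P), (A `|` P) p, (A `|` P) q &
        A `|` P `<=` \bigcup_(A in F) A `|` P].
    have sub A : F A -> A `|` P `<=` \bigcup_(A in F) A `|` P.
      by move=> FA z [Az|Pz]; [left; exists A | right].
    move=> [[A FA Ap]|Pp] [[B FB Bq]|Pq].
    - have [AB|BA] := Ftot _ _ FA FB.
      + by exists B; split; [exact: FP | left; exact: AB | left | exact: sub].
      + by exists A; split; [exact: FP | left | left; exact: BA | exact: sub].
    - by exists A; split; [exact: FP | left | right | exact: sub].
    - by exists B; split; [exact: FP | right | left | exact: sub].
    - exists set0; rewrite set0U; split=> //; exact: subsetUr.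
  split=> [v w c d|r v c r0|c].
  - by move=> /common/[apply] -[A [[AD _ _] Av Aw sA]]; apply: sA; exact: AD.
  - move=> Pv; have [A [[_ AZ _] Av _ sA]] := common _ _ Pv Pv.
    by apply: sA; exact: AZ.
  - by move=> Pv; have [A [[_ _ A0] Av _ _]] := common _ _ Pv Pv; exact: A0.
exists (A `|` P); split=> [||B QB pB]; [exact: subsetUr | exact: pA |].
apply: contrapT => nBQ; apply: (maxA B) => /=; last first.
  by rewrite (_ : B `|` P = B) //; apply/setUidl => z Pz; apply: QB; right.
split; first by move=> z Az; apply: QB; left.
by move=> BA; apply: nBQ => z /BA Az; left.
Qed.

(** If [(v, c)] is not in [Q], the cone [B] generated by both cannot be proper: [k + t *: v = 0] and
    [d + t * c > 0] for some [(k, d)] in [Q] and [t > 0]. Division by [t] then puts [(- v, d / t)]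
    in [Q]. *)
Lemma maximal_cone_dichotomy Q : proper_cone Q -> Q (0, 0) ->
  (forall B, Q `<=` B -> proper_cone B -> B `<=` Q) ->
  forall v c, Q (v, c) \/ exists2 d, - c < d & Q (- v, d).
Proof.
move=> [QD QZ Q0] Q00 maxQ v c; apply: contrapT => /not_orP[nQv nQN].
pose B := [set p : V * R | exists k d t, [/\ 0 <= t, Q (k, d) &
  p = (k + t *: v, d + t * c)]].
apply: nQv; apply: (maxQ B).
- move=> [k d] Qkd; exists k, d, 0; split=> //.
  by rewrite scale0r mul0r !addr0.
- split.
  + move=> _ _ _ _ [k [d [t [t0 Qk [-> ->]]]]] [k' [d' [t' [t'0 Qk' [-> ->]]]]].
    exists (k + k'), (d + d'), (t + t'); split; [exact: addr_ge0 | exact: QD |].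
    by rewrite scalerDl mulrDl; congr (_, _); rewrite addrACA.
  + move=> r _ _ r0 [k [d [t [t0 Qk [-> ->]]]]].
    exists (r *: k), (r * d), (r * t); split; [|exact: QZ|].
      by rewrite mulr_ge0 // ltW.
    by rewrite scalerDr scalerA mulrDr mulrA.
  + move=> _ [k [d [t [t0 Qk [kt ->]]]]].
    rewrite leNgt; apply/negP => dt.
    move: t0; rewrite le_eqVlt => /predU1P[t0|t0].
      move: kt dt Qk; rewrite -t0 scale0r mul0r !addr0 => <- d0 /Q0.
      by rewrite leNgt d0.
    apply: nQN; exists (t^-1 * d).
      by rewrite -(ltr_pM2l t0) mulrA divff ?gt_eqF // mul1r; lra.
    have -> : - v = t^-1 *: k; last by apply: QZ; rewrite ?invr_gt0.
    move/eqP: kt; rewrite eq_sym addr_eq0 => /eqP ->.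
    by rewrite scalerN scalerA mulVf ?gt_eqF // scale1r.
- by exists 0, 0, 1; split=> //; rewrite scale1r mul1r !add0r.
Qed.

(* The functional is [v |-> sup {c | Q (v, c)}] for a maximal cone [Q]. *)
Lemma sandwich P (W : set V) : proper_cone P -> P (0, 0) ->
  W 0 -> (forall a v w, W v -> W w -> W (a *: v + w)) ->
  (forall v, W v -> exists c, P (v, c)) ->
  exists L : V -> R,
    [/\ forall v w, W v -> W w -> L (v + w) = L v + L w,
        forall a v, W v -> L (a *: v) = a * L v &
        forall v c, W v -> P (v, c) -> c <= L v].
Proof.
move=> pP P00 W0 WD Pex; have [Q [PQ pQ maxQ]] := maximal_proper_cone pP.
have dich := maximal_cone_dichotomy pQ (PQ _ P00) maxQ.
case: pQ => QD QZ Q0.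
have WN v : W v -> W (- v).
  by move=> Wv; rewrite -[- v]addr0 -scaleN1r; exact: WD.
have WZ a v : W v -> W (a *: v) by move=> Wv; rewrite -[_ *: _]addr0; exact: WD.
have WA v w : W v -> W w -> W (v + w).
  by move=> Wv Ww; rewrite -[v]scale1r; exact: WD.
pose L v := sup [set c | Q (v, c)].
(* Any constraint on [- v] bounds the constraints on [v] from above. *)
have ubL v : W v -> has_ubound [set c | Q (v, c)].
  move=> /WN/Pex[d /PQ Qd]; exists (- d) => c /= Qc.
  by have := QD _ _ _ _ Qc Qd; rewrite subrr => /Q0; lra.
have supL v : W v -> has_sup [set c | Q (v, c)].
  by move=> Wv; split; [have [c /PQ Qc] := Pex _ Wv; exists c | exact: ubL].
have QL v c : W v -> Q (v, c) -> c <= L v.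
  by move=> Wv Qc; apply: ub_le_sup => //; exact: ubL.
have LQ v e : W v -> 0 < e -> exists2 c, Q (v, c) & L v - e < c.
  by move=> Wv e0; have [c /= Qc Lc] := sup_adherent e0 (supL _ Wv); exists c.
have L0 : L 0 <= 0 by apply: sup_le_ub => //; exists 0; exact: PQ.
have superD v w : W v -> W w -> L v + L w <= L (v + w).
  move=> Wv Ww; apply/ler_addgt0Pr => e e0.
  have e2 : 0 < e / 2 by lra.
  have [c Qc Lc] := LQ _ _ Wv e2; have [d Qd Ld] := LQ _ _ Ww e2.
  by have := QL _ _ (WA _ _ Wv Ww) (QD _ _ _ _ Qc Qd); lra.
(* Superadditivity gives [L (- v) <= - L v]. Conversely [(v, L v + e)] is not in [Q], so the
   dichotomy yields a constraint on [- v] above [- L v - e]. *)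
have LN v : W v -> L (- v) = - L v.
  move=> Wv; apply/eqP; rewrite eq_le; apply/andP; split.
    by have := superD _ _ Wv (WN _ Wv); rewrite subrr; lra.
  apply/ler_addgt0Pr => e e0; have [Qv|[d cd Qd]] := dich v (L v + e).
    by have := QL _ _ Wv Qv; lra.
  by have := QL _ _ (WN _ Wv) Qd; lra.
have LD v w : W v -> W w -> L (v + w) = L v + L w.
  move=> Wv Ww; apply/eqP; rewrite eq_le superD // andbT.
  have := superD _ _ (WN _ Wv) (WN _ Ww).
  by rewrite -opprD !LN ?opprD //; [lra | exact: WA].
have L00 : L 0 = 0 by have := LD _ _ W0 W0; rewrite addr0; lra.
have superZ r v : 0 < r -> W v -> r * L v <= L (r *: v).
  move=> r0 Wv; apply/ler_addgt0Pr => e e0.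
  have [c Qc Lc] := LQ _ _ Wv (divr_gt0 e0 r0).
  have := QL _ _ (WZ r _ Wv) (QZ _ _ _ r0 Qc).
  move: Lc; rewrite -(ltr_pM2l r0) mulrBr mulrCA divff ?gt_eqF // mulr1; lra.
have LZp r v : 0 < r -> W v -> L (r *: v) = r * L v.
  move=> r0 Wv; apply/eqP; rewrite eq_le superZ // andbT.
  have ri : 0 < r^-1 by rewrite invr_gt0.
  have := superZ _ _ ri (WZ r _ Wv).
  by rewrite scalerA mulVf ?gt_eqF // scale1r mulrC ler_pdivrMr // mulrC.
exists L; split=> // [a v Wv|v c Wv /PQ]; last exact: QL.
have [a0|a0|->] := ltgtP a 0; [|exact: LZp|by rewrite scale0r mul0r].
by rewrite -[a]opprK scaleNr mulNr LN ?LZp ?oppr_gt0 //; exact: WZ.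
Qed.

End sandwich.

(** * Dini's theorem and open sets of metric spaces *)

Lemma small_multiple (R : realFieldType) (m e : R) : 0 <= m -> 0 < e ->
  exists2 d, 0 < d & d * m <= e.
Proof.
move=> m0 e0; have m1 : 0 < m + 1 by lra.
exists (e / (m + 1)); first exact: divr_gt0.
by rewrite mulrAC ler_pdivrMr // ler_wpM2l ?ltW //; lra.
Qed.

(** By monotonicity, [D i y < 0] persists near [y] for all later indices; compactness then provides
    a common index. *)
Lemma dini_lt0 (R : realType) (X : topologicalType) (D : (X -> R)^nat) :
  compact [set: X] -> (forall i, continuous (D i)) ->
  (forall y, nonincreasing_seq (D^~ y)) -> (forall y, exists i, D i y < 0) ->
  exists i, forall y, D i y < 0.
Proof.
move=> /compact_near_coveringP cX cD dD D0.
have [|N _ NP] := cX nat \oo (fun i y => D i y < 0).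
  move=> y _; have [i Di] := D0 y.
  exists ([set z | D i z < 0], [set j | (i <= j)%N]) => /=.
    split; last by exists i.
    have := cD i y; move/cvgr_lt; exact.
  by move=> [z j] /= [Dz ij]; exact: le_lt_trans (dD z _ _ ij) Dz.
by exists N => y; exact: (NP N (leqnn N)).
Qed.

(** [d] is the distance to the complement of [U]. An empty complement is treated apart, since the
    infimum of the empty set is [0] here. *)
Lemma open_gt0_continuous (R : realType) (X : metricType R) (U : set X) :
  open U -> exists d : X -> R,
    [/\ continuous d, forall y, 0 <= d y & forall y, U y <-> 0 < d y].
Proof.
move=> oU; have [UT|UC0] := eqVneq (~` U) set0.
  exists (cst 1); split=> // y; [exact: cvg_cst | split=> // _].
  by apply: contrapT => nUy; have : (~` U) y by []; rewrite UT.
pose d y := inf [set mdist y z | z in ~` U].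
have lbd y : has_lbound [set mdist y z | z in ~` U].
  by exists 0 => _ [z _ <-]; exact: mdist_ge0.
have nE y : [set mdist y z | z in ~` U] !=set0.
  by case/set0P: UC0 => z Uz; exists (mdist y z), z.
have d0 y : 0 <= d y.
  by apply: lb_le_inf => // _ [z _ <-]; exact: mdist_ge0.
have lip y z : d y <= mdist y z + d z.
  rewrite -lerBlDl; apply: lb_le_inf => // _ [w Uw <-].
  rewrite lerBlDl; apply: le_trans (metric_triangle y z w).
  by apply: ge_inf => //; exists w.
exists d; split=> // y.
- apply/cvgrPdist_lt => e e0.
  have : nbhs y (ball y e) by exact: nbhsx_ballx.
  apply: filterS => z; rewrite ballEmdist /= => yz.
  have := lip y z; have := lip z y; rewrite (metric_sym z y) => *.
  by rewrite ltr_norml; apply/andP; split; lra.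
- split=> [Uy|]; last first.
    apply: contraPP => nUy; apply/negP; rewrite -leNgt.
    by apply: ge_inf => //; exists y => //; exact: mdistxx.
  have := open_nbhs_nbhs (conj oU Uy); rewrite -nbhs_ballE => -[e /= e0 eU].
  apply: lt_le_trans e0 _; apply: lb_le_inf => // _ [z Uz <-].
  by rewrite leNgt; apply/negP => yz; apply: Uz; apply: eU; rewrite ballEmdist.
Qed.

(** * The Daniell outer measure of a positive functional *)

(** The carrier acts on all functions, but its laws concern only continuous ones: a functional
    obtained by [sandwich] is linear only on the subspace [W]. *)
Record positive_functional (R : realType) (X : topologicalType) := {
  pfun :> (X -> R) -> R;
  pfunD : forall f g : X -> R, continuous f -> continuous g ->
    pfun (f \+ g) = pfun f + pfun g;
  pfunZ : forall (a : R) (f : X -> R), continuous f ->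
    pfun (fun y => a * f y) = a * pfun f;
  pfun_ge0 : forall f : X -> R, continuous f -> (forall y, 0 <= f y) ->
    0 <= pfun f }.

Section positive_functional_theory.
Context {R : realType} {X : topologicalType} (L : positive_functional R X).
Implicit Types f g : X -> R.

Lemma pfun0 : L (cst 0) = 0.
Proof.
rewrite (_ : cst 0 = fun y : X => 0 * cst 0 y :> R); last first.
  by apply/funext => y; rewrite mul0r.
by rewrite pfunZ ?mul0r //; exact: cst_continuous.
Qed.

Lemma pfun_cst (a : R) : L (cst a) = a * L (cst 1).
Proof.
rewrite -pfunZ; last exact: cst_continuous.
by congr (L _); apply/funext => y; rewrite /= mulr1.
Qed.

Lemma continuousN f : continuous f -> continuous (fun y => - f y).
Proof. by move=> cf y; apply: cvgN; exact: cf. Qed.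

Lemma continuousB f g : continuous f -> continuous g ->
  continuous (fun y => f y - g y).
Proof. by move=> cf cg y; apply: cvgB; [exact: cf | exact: cg]. Qed.

Lemma continuous_sum (G : nat -> X -> R) n : (forall i, continuous (G i)) ->
  continuous (fun y => \sum_(i < n) G i y).
Proof. by move=> cG; apply: continuous_big => [|i _]; [exact: add_continuous|]. Qed.

Lemma pfunN f : continuous f -> L (fun y => - f y) = - L f.
Proof.
move=> cf; rewrite -mulN1r -pfunZ //.
by congr (L _); apply/funext => y; rewrite mulN1r.
Qed.

Lemma pfunB f g : continuous f -> continuous g ->
  L (fun y => f y - g y) = L f - L g.
Proof. by move=> cf cg; rewrite -pfunN // -pfunD //; exact: continuousN. Qed.

Lemma pfun_le f g : continuous f -> continuous g -> (forall y, f y <= g y) ->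
  L f <= L g.
Proof.
move=> cf cg fg; rewrite -subr_ge0 -pfunB //; apply: pfun_ge0.
  exact: continuousB.
by move=> y; rewrite subr_ge0.
Qed.

Lemma pfun_sum (G : nat -> X -> R) n : (forall i, continuous (G i)) ->
  L (fun y => \sum_(i < n) G i y) = \sum_(i < n) L (G i).
Proof.
move=> cG; elim: n => [|n IH].
  rewrite big_ord0 (_ : (fun y => _) = cst 0) ?pfun0 //.
  by apply/funext => y; rewrite big_ord0.
rewrite big_ord_recr /= -IH -pfunD //; last exact: continuous_sum.
by congr (L _); apply/funext => y; rewrite big_ord_recr.
Qed.

(* Countable covers by functions are encoded as increasing sequences (partial
   sums) instead of series, so that subadditivity follows by taking the diagonal
   sequence [\sum_(i < N) G i N] and needs no double series. *)
Definition covers (G : nat -> X -> R) (A : set X) (c : R) :=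
  [/\ forall n, continuous (G n), forall n y, 0 <= G n y,
      forall y, nondecreasing_seq (G^~ y), forall n, L (G n) <= c &
      forall y, A y -> exists n, 1 < G n y].

Definition daniell_outer (A : set X) : \bar R :=
  ereal_inf [set c%:E | c in [set c | exists G, covers G A c]].

Lemma daniell_outer_le G A c : covers G A c -> (daniell_outer A <= c%:E)%E.
Proof. by move=> GA; apply: ereal_inf_lbound; exists c => //; exists G. Qed.

Lemma daniell_outer_ltP A e : (daniell_outer A < e)%E ->
  exists G c, covers G A c /\ (c%:E < e)%E.
Proof. by move=> /ereal_inf_lt[_ [c [G GA] <-] ce]; exists G, c. Qed.

Lemma covers_cst A (c : R) : 1 < c -> covers (fun=> cst c) A (c * L (cst 1)).
Proof.
move=> c1; split=> [n|n y|y m n mn|n|y _].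
- exact: cst_continuous.
- by rewrite /= ltW // (lt_trans _ c1).
- by [].
- by rewrite pfun_cst.
- by exists 0%N.
Qed.

Lemma daniell_outer_le1 A : (daniell_outer A <= (L (cst 1))%:E)%E.
Proof.
apply/lee_addgt0Pr => e e0.
have L1 : 0 <= L (cst 1) by apply: pfun_ge0 => // ?; exact: cst_continuous.
have [d d0 dL] := small_multiple L1 e0.
apply: le_trans (daniell_outer_le (covers_cst A (_ : 1 < 1 + d))) _; first lra.
by rewrite -EFinD lee_fin mulrDl mul1r lerD2l.
Qed.

Lemma daniell_outer_ge0 A : (0 <= daniell_outer A)%E.
Proof.
apply: le_ereal_inf_tmp => _ [c [G [cG G0 _ Gc _]] <-]; rewrite lee_fin.
by apply: le_trans (Gc 0%N); exact: pfun_ge0.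
Qed.

Lemma daniell_outer0 : daniell_outer set0 = 0%E.
Proof.
apply/eqP; rewrite eq_le daniell_outer_ge0 andbT.
apply: (@daniell_outer_le (fun=> cst 0)); split=> //.
- by move=> n; exact: cst_continuous.
- by move=> y m n _.
- by rewrite pfun0.
Qed.

Lemma le_daniell_outer : {homo daniell_outer : A B / A `<=` B >-> (A <= B)%E}.
Proof.
move=> A B AB; apply: le_ereal_inf_tmp => _ [c [G [cG G0 ndG Gc GB]] <-].
by apply: (@daniell_outer_le G); split=> // y /AB; exact: GB.
Qed.

Lemma daniell_outer_fin A : daniell_outer A \is a fin_num.
Proof.
by rewrite ge0_fin_numE ?daniell_outer_ge0 // (le_lt_trans (daniell_outer_le1 A)) ?ltry.
Qed.

Lemma daniell_outer_sigma_subadditive : sigma_subadditive daniell_outer.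
Proof.
move=> A; have [->|Soo] := eqVneq (\sum_(i <oo) daniell_outer (A i))%E +oo%E.
  by rewrite leey.
set S := (\sum_(i <oo) _)%E in Soo *.
have S0 : (0 <= S)%E by apply: nneseries_ge0 => i _ _; exact: daniell_outer_ge0.
have Sfin : S \is a fin_num by rewrite ge0_fin_numE // ltey.
apply/lee_addgt0Pr => e e0.
have /choice[G /choice[c Gc]] : forall i, exists G c, covers G (A i) c /\
    (c%:E < daniell_outer (A i) + (e / (2 ^ i.+1)%:R)%:E)%E.
  move=> i; apply: daniell_outer_ltP; rewrite lteDl ?daniell_outer_fin // lte_fin.
  by rewrite divr_gt0 // ltr0n expn_gt0.
pose H N y := \sum_(i < N) G i N y.
rewrite -(fineK Sfin) -EFinD; apply: (@daniell_outer_le H).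
have cG i n : continuous (G i n) by case: (Gc i) => -[].
have G0 i n y : 0 <= G i n y by case: (Gc i) => -[].
have ndG i y : nondecreasing_seq ((G i)^~ y) by case: (Gc i) => -[].
split.
- by move=> N; exact: (continuous_sum (G := fun i => G i N)).
- by move=> N y; apply: sumr_ge0.
- move=> y; apply/nondecreasing_seqP => N; rewrite /H big_ord_recr /=.
  by rewrite -[leLHS]addr0 lerD // ler_sum // => i _; exact: ndG.
- move=> N; rewrite /H (pfun_sum (G := fun i => G i N)) // -lee_fin EFinD fineK //.
  apply: (@le_trans _ _ (\sum_(i < N) (daniell_outer (A i) + (e / (2 ^ i.+1)%:R)%:E))%E).
    rewrite -sumEFin; apply: lee_sum => i _; case: (Gc i) => -[_ _ _ + _] /ltW.
    by move=> GN; apply: le_trans; rewrite lee_fin.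
  rewrite big_split /= leeD //.
    rewrite -(big_mkord xpredT (fun i => daniell_outer (A i))).
    by apply: nneseries_lim_ge => i _ _; exact: daniell_outer_ge0.
  rewrite sumEFin lee_fin.
  have -> : \sum_(i < N) e / (2 ^ i.+1)%:R = e - e / (2 ^ N)%:R.
    elim: N => [|N IH]; first by rewrite big_ord0 expn0 divr1 subrr.
    rewrite big_ord_recr /= IH expnS natrM.
    have : (2 ^ N)%:R != 0 :> R by rewrite pnatr_eq0 expn_eq0.
    by move=> ?; field.
  by rewrite gerBl divr_ge0 // ltW.
- move=> y [i _ Ay]; have [[_ _ _ _ /(_ _ Ay)[n Gn]] _] := Gc i.
  (* An index above [i] makes the [i]-th cover occur in the diagonal sum, and one above [n] makes it
     exceed [1] at [y]. *)
  exists (maxn n i.+1); apply: lt_le_trans Gn _.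
  have im : (i < maxn n i.+1)%N by rewrite leq_max leqnn orbT.
  rewrite /H (bigD1 (Ordinal im)) //= -[leLHS]addr0 lerD ?sumr_ge0 //.
  by apply: ndG; rewrite leq_maxl.
Qed.

HB.instance Definition _ := isOuterMeasure.Build R X daniell_outer
  daniell_outer0 daniell_outer_ge0 le_daniell_outer
  daniell_outer_sigma_subadditive.

(** A cover [G] of [A] is split by [phi n], which increases to the indicator of [U]: the products
    [G n * phi n] cover the part of [A] in [U], the products [G n * (1 - phi k)] the part outside,
    and for [k] large the two bounds add up to nearly [c]. *)
Lemma daniell_caratheodory_gt0 (d : X -> R) : continuous d ->
  (forall y, 0 <= d y) -> daniell_outer.-caratheodory [set y | 0 < d y].
Proof.
move=> cd d0; apply: le_caratheodory_measurable => A /=; set U := [set y | 0 < d y].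
apply: le_ereal_inf_tmp => _ [c [G [cG G0 ndG Gc GA]] <-].
pose phi n y := Num.min 1 (n%:R * d y).
have cphi n : continuous (phi n).
  move=> y; apply: (@continuous_min _ _ (cst 1) (fun z => n%:R * d z)).
    exact: cvg_cst.
  by apply: cvgM; [exact: cvg_cst | exact: cd].
have phi0 n y : 0 <= phi n y by rewrite /phi le_min ler01 mulr_ge0.
have phi1 n y : phi n y <= 1 by rewrite /phi ge_min lexx.
have ndphi y m n : (m <= n)%N -> phi m y <= phi n y.
  move=> mn; rewrite /phi le_min ge_min lexx /= ge_min; apply/orP; right.
  by rewrite ler_wpM2r // ler_nat.
have cGphi m n : continuous (fun y => G m y * phi n y).
  by move=> y; apply: cvgM; [exact: cG | exact: cphi].
pose a n := L (fun y => G n y * phi n y).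
have ac n : a n <= c.
  by apply: le_trans (Gc n); apply: pfun_le => // y; rewrite ler_piMr.
have nda m n : (m <= n)%N -> a m <= a n.
  by move=> mn; apply: pfun_le => // y; apply: ler_pM => //; [exact: ndG | exact: ndphi].
have supa : has_sup (range a).
  by split; [exists (a 0%N), 0%N | exists c => _ [n _ <-]].
have inU : (daniell_outer (A `&` U) <= (sup (range a))%:E)%E.
  apply: (@daniell_outer_le (fun n y => G n y * phi n y)); split=> //.
  - by move=> n y; rewrite mulr_ge0.
  - by move=> y m n mn; apply: ler_pM => //; [exact: ndG | exact: ndphi].
  - by move=> n; apply: ub_le_sup; [case: supa | exists n].
  - move=> y [/GA[n Gn] Uy].
    have [k kd] : exists k : nat, 1 <= k%:R * d y.
      have [k dk] := ltr_add_invr Uy; exists k.+1.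
      have k0 : 0 < k.+1%:R :> R by rewrite ltr0n.
      by have := ler_wpM2l (ltW k0) (ltW dk); rewrite add0r divff ?gt_eqF.
    exists (maxn n k); have -> : phi (maxn n k) y = 1.
      apply/eqP; rewrite eq_le phi1 /= /phi le_min lexx (le_trans kd) //.
      by rewrite ler_wpM2r // ler_nat leq_maxr.
    by rewrite mulr1 (lt_le_trans Gn) // ndG // leq_maxl.
have outU : (daniell_outer (A `&` ~` U) <= (c - sup (range a))%:E)%E.
  apply/lee_addgt0Pr => e e0; rewrite -EFinD.
  (* [k] stays fixed, because [G n * (1 - phi n)] need not be monotone in [n]. *)
  have [_ [k _ <-] ka] := sup_adherent e0 supa.
  apply: (@daniell_outer_le (fun n y => G n y * (1 - phi k y))).
  have cone n : continuous (fun y => G n y * (1 - phi k y)).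
    move=> y; apply: cvgM; first exact: cG.
    by apply: cvgB; [exact: cvg_cst | exact: cphi].
  split=> //.
  - by move=> n y; rewrite mulr_ge0 // subr_ge0.
  - by move=> y m n mn; rewrite ler_wpM2r ?subr_ge0 //; exact: ndG.
  (* At the index [maxn n k], the part removed, [G (maxn n k) * phi k], has functional value at
     least [a k]. *)
  - move=> n; apply: (@le_trans _ _ (L (fun y => G (maxn n k) y * (1 - phi k y)))).
      apply: pfun_le => // y; rewrite ler_wpM2r ?subr_ge0 //.
      by apply: ndG; rewrite leq_maxl.
    rewrite (_ : (fun y => _) =
      (fun y => G (maxn n k) y - G (maxn n k) y * phi k y)); last first.
      by apply/funext => y; rewrite mulrBr mulr1.
    rewrite pfunB //; have := Gc (maxn n k).
    have : a k <= L (fun y => G (maxn n k) y * phi k y).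
      apply: pfun_le => // y; rewrite ler_wpM2r //.
      by apply: ndG; rewrite leq_maxr.
    lra.
  - move=> y [/GA[n Gn] nUy]; exists n; rewrite (_ : phi k y = 0) ?subr0 ?mulr1 //.
    have dy0 : d y = 0 by apply/eqP; rewrite eq_le d0 andbT leNgt; exact/negP.
    by rewrite /phi dy0 mulr0 min_r.
by apply: le_trans (leeD inU outU) _; rewrite -EFinD lee_fin; lra.
Qed.

(** For a cover [G] of [A], [f] is at most [1 < G n] for some [n] at each point of [A] and is [0]
    elsewhere, so Dini gives [f < G i + d] everywhere for a single [i]. *)
Lemma daniell_outer_ge f A : compact [set: X] -> continuous f ->
  (forall y, 0 <= f y <= 1) -> (forall y, f y != 0 -> A y) ->
  ((L f)%:E <= daniell_outer A)%E.
Proof.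
move=> cX cf f01 fA.
apply: le_ereal_inf_tmp => _ [c [G [cG G0 ndG Gc GA]] <-]; rewrite lee_fin.
have L1 : 0 <= L (cst 1) by apply: pfun_ge0 => // ?; exact: cst_continuous.
apply/ler_addgt0Pr => e e0; have [d d0 dL] := small_multiple L1 e0.
have [|||i fG] := @dini_lt0 R X (fun i y => f y - G i y - d) cX.
- move=> i; apply: continuousB; last exact: cst_continuous.
  exact: continuousB.
- by move=> y m n mn; rewrite lerD2r lerD2l lerN2; exact: ndG.
- move=> y; have /andP[_ f1] := f01 y; have [fy0|/fA/GA[n Gn]] := eqVneq (f y) 0.
    by exists 0%N; rewrite fy0; have := G0 0%N y; lra.
  by exists n; lra.
have : L f <= L (G i \+ cst d).
  apply: pfun_le => // [|y]; last by have := fG y; rewrite /=; lra.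
  by move=> y; apply: cvgD; [exact: cG | exact: cvg_cst].
rewrite pfunD //; last exact: cst_continuous.
by rewrite pfun_cst; have := Gc i; lra.
Qed.

End positive_functional_theory.

(** * The Riesz representation theorem on a compact metric space *)

Lemma continuous_borel_measurable (R : realType) (X : topologicalType) (x : X)
  (f : X -> R) : continuous f -> measurable_fun setT (f : borel x -> R).
Proof.
move=> cf; apply: (measurability _ (RGenOInfty.measurableE R)).
move=> _ [_ [a ->] <-]; rewrite setTI; apply: sub_sigma_algebra.
rewrite preimage_itvoy.
by apply: (open_comp (f := f) (D := [set z | a < z])) => [y _|]; [exact: cf | exact: open_gt].
Qed.

Lemma bounded_continuous (R : realType) (X : topologicalType) (f : X -> R) :
  compact [set: X] -> continuous f -> exists M, 0 <= M /\ forall y, `|f y| <= M.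
Proof.
move=> cX cf.
have : compact (f @` setT).
  by apply: continuous_compact => //; exact: continuous_subspaceT.
move=> /compact_bounded[M [_ bM]]; exists (`|M| + 1); split=> [|y].
  by rewrite addr_ge0.
by apply: bM; [rewrite ltr_pwDr // ler_norm | exists y].
Qed.

Lemma continuous_integrable (R : realType) (X : topologicalType) (x : X)
    (mu : {finite_measure set (borel x) -> \bar R}) (f : X -> R) :
  compact [set: X] -> continuous f ->
  mu.-integrable setT (EFin \o f : borel x -> \bar R).
Proof.
move=> cX cf; apply: measurable_bounded_integrable => //.
- by rewrite ltey_eq fin_num_measure.
- exact: continuous_borel_measurable.
- have [M [_ bM]] := bounded_continuous cX cf.
  by exists M; split=> [|a Ma y _]; [exact: num_real | apply: le_trans (bM y) (ltW Ma)].
Qed.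

Section riesz_measure.
Context {R : realType} {X : metricType R}.
Variables (L : positive_functional R X) (x : X).
Local Notation cara := (daniell_outer L : set (pointed_at x) -> \bar R).-caratheodory.

(** The Caratheodory sets form a sigma-algebra, and it contains the open sets because in a metric
    space each of them is the positivity set of a continuous function. *)
Lemma borel_caratheodory (A : set (borel x)) : measurable A -> cara A.
Proof.
apply: smallest_sub.
  split.
  - exact: caratheodory_measurable_set0.
  - by move=> B cB; rewrite setTD; exact: caratheodory_measurable_setC.
  - by move=> B cB; exact: caratheodory_measurable_bigcup.
move=> U oU; have [d [cd d0 Ud]] := open_gt0_continuous (X := X) oU.
rewrite (_ : U = [set y | 0 < d y]); first exact: daniell_caratheodory_gt0.
by apply/seteqP; split=> y /Ud.
Qed.

Definition riesz_measure (A : set (borel x)) : \bar R := daniell_outer L A.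

Let riesz_measure0 : riesz_measure set0 = 0%E.
Proof. exact: daniell_outer0. Qed.

Let riesz_measure_ge0 A : (0 <= riesz_measure A)%E.
Proof. exact: daniell_outer_ge0. Qed.

Let riesz_measure_sigma_additive : semi_sigma_additive riesz_measure.
Proof.
move=> A mA tA mUA.
apply: (@caratheodory_measure_sigma_additive R (pointed_at x) (daniell_outer L)) => //.
- by move=> i; exact: borel_caratheodory.
- exact: borel_caratheodory.
Qed.

HB.instance Definition _ := isMeasure.Build _ _ _ riesz_measure
  riesz_measure0 riesz_measure_ge0 riesz_measure_sigma_additive.

Let riesz_measure_fin : fin_num_fun riesz_measure.
Proof. by move=> A _; exact: daniell_outer_fin. Qed.

HB.instance Definition _ := Measure_isFinite.Build _ _ _ riesz_measure
  riesz_measure_fin.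

Hypothesis cX : compact [set: X].

Local Notation mu := (riesz_measure : {finite_measure set (borel x) -> \bar R}).
Let I (f : X -> R) := (\int[mu]_y f y)%R.

Let ID (f g : X -> R) : continuous f -> continuous g -> I (f \+ g) = I f + I g.
Proof.
by move=> cf cg; rewrite /I RintegralD //; exact: continuous_integrable.
Qed.

Let I_cst (a : R) : I (cst a) = a * fine (mu setT).
Proof. by rewrite /I Rintegral_cst. Qed.

Let measurable_gt0 (f : X -> R) : continuous f ->
  measurable ([set y | 0 < f y] : set (borel x)).
Proof.
move=> cf; apply: sub_sigma_algebra.
by apply: (open_comp (f := f) (D := [set z | 0 < z])) => [y _|];
  [exact: cf | exact: open_gt].
Qed.

(** Divided by [d], the layer [f \min cst d] takes values in [[0, 1]] and vanishes off the
    positivity set of [f], so [daniell_outer_ge] applies. *)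
Let truncate_le (f : X -> R) (d : R) :
  continuous f -> 0 < d -> (forall y, 0 <= f y) ->
  L (f \min cst d) <= d * fine (mu [set y | 0 < f y]).
Proof.
move=> cf d0 f0; have cm : continuous (f \min cst d).
  by move=> y; apply: continuous_min; [exact: cf | exact: cvg_cst].
have cg : continuous (fun y => d^-1 * (f \min cst d) y).
  by move=> y; apply: cvgM; [exact: cvg_cst | exact: cm].
have -> : f \min cst d = (fun y => d * (d^-1 * (f \min cst d) y)).
  by apply/funext => y; rewrite mulrA divff ?gt_eqF // mul1r.
rewrite pfunZ // ler_pM2l // -lee_fin fineK ?fin_num_measure //; last first.
  exact: measurable_gt0.
apply: (@daniell_outer_ge R X L _ [set y | 0 < f y] cX) => // y.
  have di : 0 < d^-1 by rewrite invr_gt0.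
  apply/andP; split; first by rewrite mulr_ge0 ?(ltW di) //= le_min f0 ltW.
  by rewrite mulrC ler_pdivrMr // mul1r ge_min lexx orbT.
apply: contra_neqP => /negP; rewrite -leNgt /= => fy.
have -> : f y = 0 by apply/eqP; rewrite eq_le fy f0.
by rewrite min_l ?mulr0 // ltW.
Qed.

(** The layer equals [d] wherever [f > d]. *)
Let truncate_ge (f : X -> R) (d : R) :
  continuous f -> 0 < d -> (forall y, 0 <= f y) ->
  d * fine (mu [set y | 0 < f y - d]) <= I (f \min cst d).
Proof.
move=> cf d0 f0; have cm : continuous (f \min cst d).
  by move=> y; apply: continuous_min; [exact: cf | exact: cvg_cst].
have mA : measurable ([set y | 0 < f y - d] : set (borel x)).
  apply: measurable_gt0; apply: continuousB => //; exact: cst_continuous.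
rewrite -lee_fin EFinM !fineK ?fin_num_measure //; last first.
  exact/integrable_fin_num/continuous_integrable.
have mm : measurable_fun setT (EFin \o (f \min cst d) : borel x -> \bar R).
  by apply/measurable_EFinP; exact: continuous_borel_measurable.
have m0 y : (0 <= (f \min cst d) y)%R by rewrite le_min f0 ltW.
rewrite -integral_cst //.
apply: (@le_trans _ _ (\int[mu]_(y in [set y | (0 < f y - d)%R])
    ((f \min cst d) y)%:E)%E); last first.
  by apply: ge0_subset_integral => // y _; rewrite lee_fin.
apply: ge0_le_integral => //.
- by move=> y _; rewrite lee_fin ltW.
- exact: measurable_funS mm.
- by move=> y /=; rewrite subr_gt0 => /ltW fd; rewrite lee_fin le_min fd lexx.
Qed.

(* Peeling off one layer [min f d] at a time, the errors telescope. *)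
Let layer_cake n (d : R) : 0 < d -> forall f : X -> R, continuous f ->
  (forall y, 0 <= f y <= n%:R * d) ->
  L f <= I f + d * fine (mu [set y | 0 < f y]).
Proof.
move=> d0; elim: n => [|n IH] f cf f0n.
  have -> : f = cst 0.
    apply/funext => y; apply/eqP; have := f0n y.
    by rewrite mulr0n mul0r eq_le andbC.
  by rewrite pfun0 I_cst mul0r add0r mulr_ge0 ?fine_ge0 // ltW.
have f0 y : 0 <= f y by case/andP: (f0n y).
have cm : continuous (f \min cst d).
  by move=> y; apply: continuous_min; [exact: cf | exact: cvg_cst].
pose g y := f y - Num.min (f y) d.
have cg : continuous g by apply: continuousB.
have fE : f = (f \min cst d) \+ g by apply/funext => y; rewrite /g /= addrC subrK.
have g0n y : 0 <= g y <= n%:R * d.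
  have := f0n y; rewrite -natr1 mulrDl mul1r /g => /andP[? ?].
  by have [?|?] := leP (f y) d; apply/andP; split; rewrite ?subrr ?mulr_ge0 //;
    [exact: ltW | lra | lra].
(* This is why the errors telescope: the lower bound for the integral of this layer cancels the
   error term of the remaining function [g]. *)
have gE : [set y | 0 < g y] = [set y | 0 < f y - d].
  apply/seteqP; split=> y /=; rewrite /g; have [] := leP (f y) d; lra.
have := IH g cg g0n; rewrite gE.
have := truncate_le cf d0 f0; have := truncate_ge cf d0 f0.
have -> : L f = L (f \min cst d) + L g by rewrite {1}fE pfunD.
have -> : I f = I (f \min cst d) + I g by rewrite {1}fE ID.
lra.
Qed.

Let riesz_le_ge0 (f : X -> R) : continuous f -> (forall y, 0 <= f y) ->
  L f <= I f.
Proof.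
move=> cf f0; apply/ler_addgt0Pr => e e0.
have [d d0 dm] := small_multiple (fine_ge0 (measure_ge0 mu setT)) e0.
have [M [M0 bM]] := bounded_continuous cX cf.
have [n Mn] : exists n : nat, M <= n%:R * d.
  exists (Num.truncn (M / d)).+1; rewrite -ler_pdivrMr //.
  by apply/ltW; rewrite truncnS_gt.
apply: (@le_trans _ _ (I f + d * fine (mu [set y | 0 < f y]))).
  apply: (layer_cake (n := n)) => // y; rewrite f0 (le_trans _ Mn) //.
  exact: le_trans (ler_norm _) (bM y).
rewrite lerD2l; apply: le_trans dm.
rewrite ler_wpM2l ?fine_le ?fin_num_measure //; [exact: ltW| |].
  exact: measurable_gt0.
by apply: le_measure; rewrite ?inE //; exact: measurable_gt0.
Qed.

(** The nonnegative case applies to [f + M]. The constant can then be removed because the total mass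
    is at most [L (cst 1)]. *)
Let riesz_le (f : X -> R) : continuous f -> L f <= I f.
Proof.
move=> cf; have [M [M0 bM]] := bounded_continuous cX cf.
have cfM : continuous (f \+ cst M).
  by move=> y; apply: cvgD; [exact: cf | exact: cvg_cst].
have fM0 y : 0 <= (f \+ cst M) y.
  by rewrite /=; have := bM y; rewrite ler_norml => /andP[]; lra.
have mu1 : fine (mu setT) <= L (cst 1).
  by rewrite -lee_fin fineK ?fin_num_measure //; exact: daniell_outer_le1.
have aux (a b c m : R) : M * m <= M * c -> a + M * c <= b + M * m -> a <= b by lra.
apply: aux (ler_wpM2l M0 mu1) _; have := riesz_le_ge0 cfM fM0.
have -> : L (f \+ cst M) = L f + M * L (cst 1).
  by rewrite -pfun_cst pfunD //; exact: cst_continuous.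
by rewrite -I_cst -ID //; exact: cst_continuous.
Qed.

(** The inequality [riesz_le] is used for [f] and for [- f]. *)
Lemma riesz_integral (f : X -> R) : continuous f ->
  (\int[mu]_y (f y)%:E = (L f)%:E)%E.
Proof.
move=> cf; have fint := integrable_fin_num _ (continuous_integrable mu cX cf).
rewrite -[LHS]fineK //; last exact: fint.
congr (_%:E); apply/eqP; rewrite eq_le; apply/andP; split; last exact: riesz_le.
have cN := continuousN cf; have := riesz_le cN; rewrite pfunN //.
have := ID cf cN; rewrite (_ : f \+ _ = cst 0); last first.
  by apply/funext => y; rewrite /= subrr.
by rewrite I_cst mul0r /I /Rintegral /=; lra.
Qed.

End riesz_measure.

Arguments riesz_measure {R X} L x A.

(** * Consequences of totality *)

Section monotone_limits.
Context {R : realType} {T : Type}.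
Implicit Types (h : (T -> R)^nat) (g : T -> \bar R).

Lemma decreases_to_ge h g i y : decreases_to h g -> (g y <= (h i y)%:E)%E.
Proof.
move=> /(_ y)[nd cvgh]; rewrite -(cvg_lim _ cvgh) //; apply: lime_le.
  by apply/cvg_ex; exists (g y).
by exists i => // j /= ij; rewrite lee_fin; exact: nd.
Qed.

Lemma decreases_to_lt h g c y : decreases_to h g -> (g y < c%:E)%E ->
  exists i, h i y < c.
Proof.
move=> /(_ y)[nd cvgh]; apply: contraPP => /forallNP hc; apply/negP.
rewrite -leNgt -(cvg_lim _ cvgh) //; apply: lime_ge.
  by apply/cvg_ex; exists (g y).
by apply: nearW => i; rewrite lee_fin leNgt; exact/negP.
Qed.

Lemma increases_to_le h g i y : increases_to h g -> ((h i y)%:E <= g y)%E.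
Proof.
move=> /(_ y)[nd cvgh]; rewrite -(cvg_lim _ cvgh) //; apply: lime_ge.
  by apply/cvg_ex; exists (g y).
by exists i => // j /= ij; rewrite lee_fin; exact: nd.
Qed.

Lemma decreases_toN h g : decreases_to h g ->
  increases_to (fun i y => - h i y) (fun y => - g y)%E.
Proof.
move=> hg y; have [nd cvgh] := hg y; split=> [i j ij|].
  by rewrite lerN2; exact: nd.
by under eq_fun do rewrite EFinN; exact: cvgeN.
Qed.

End monotone_limits.

Lemma dini_decreases_to (R : realType) (X : topologicalType)
    (h : (X -> R)^nat) (g : X -> \bar R) (f : X -> R) :
  compact [set: X] -> (forall i, continuous (h i)) -> decreases_to h g ->
  continuous f -> (forall y, g y < (f y)%:E)%E ->
  exists i, forall y, h i y < f y.
Proof.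
move=> cX ch hg cf gf; have [|||i hf] := @dini_lt0 R X (fun i y => h i y - f y) cX.
- by move=> i; exact: continuousB.
- by move=> y m n mn; rewrite lerD2r; have [+ _] := hg y; exact.
- by move=> y; have [i hi] := decreases_to_lt hg (gf y); exists i; rewrite subr_lt0.
- by exists i => y; have := hf y; rewrite subr_lt0.
Qed.

Section sup_norm.
Context {R : realType} {X : topologicalType}.

Lemma sup_norm_le (f : X -> R) (x : X) (M : R) :
  (forall y, `|f y| <= M) -> sup_norm f <= M.
Proof. by move=> fM; apply: sup_le_ub => [|_ [z _ <-] //]; exists `|f x|, x. Qed.

End sup_norm.

(** * Approximation of truncated functions by elements of [H] *)

Section truncation.
Context {R : realType} {X : topologicalType} (H : set (X -> R)).
Hypotheses (cX : compact [set: X]) (HC : subspace_of_C H).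

(** As [e > 0], the compact set [e <= h] of [X] avoids the common zeros of [H]. A filter on the
    subtype is pushed forward to [X], and its cluster point lifts back. *)
Lemma compact_superlevel (h : X -> R) (e : R) : H h -> 0 < e ->
  compact [set z : ~` zeros H | e <= h (\val z)].
Proof.
move=> Hh e0; have ch : continuous h by case: HC => + _ _; exact.
move=> F FF FK.
have cB : compact [set y | e <= h y].
  apply: subclosed_compact cX _ => //.
  by apply: (closed_comp (f := h) (D := [set t | e <= t])) => [y _|];
    [exact: ch | exact: closed_ge].
have [p [ep clp]] := cB (fmap (fun z : ~` zeros H => \val z) F) _ FK.
have Zp : p \in ~` zeros H.
  by rewrite inE /= => /(_ _ Hh) hp; move: ep; rewrite /= hp leNgt e0.
exists (exist _ p Zp); split=> // A B FA.
rewrite nbhsE => -[_ [[W oW <-] Wp] WB].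
have FvA : F ((fun z : ~` zeros H => \val z) @^-1` ((fun z => \val z) @` A)).
  by apply: filterS FA => z Az; exists z.
have [_ [[z Az <-] Wz]] := clp _ W FvA (open_nbhs_nbhs (conj oW Wp)).
by exists z; split=> //; exact: WB.
Qed.

(** Subtracting [e] before taking the positive part confines the support to the compact set
    [e <= h]. *)
Lemma truncation_Cc (h : X -> R) (e : R) : H h -> 0 < e ->
  Cc (fun z : ~` zeros H => Num.max (h (\val z) - e) 0).
Proof.
move=> Hh e0; have ch : continuous h by case: HC => + _ _; exact.
have chv : continuous (fun z : ~` zeros H => h (\val z)).
  move=> z; apply: (@continuous_comp _ _ _ (fun z : ~` zeros H => \val z) h).
    exact: initial_continuous.
  exact: ch.
split.
  move=> z; apply: (@continuous_max _ _ (fun z : ~` zeros H => h (\val z) - e) (cst 0)).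
    exact: (continuousB chv (@cst_continuous _ _ e)).
  exact: cst_continuous.
apply: subclosed_compact (compact_superlevel Hh e0) _; first exact: closed_closure.
have cK : closed [set z : ~` zeros H | e <= h (\val z)].
  by apply: (closed_comp (f := fun z : ~` zeros H => h (\val z)) (D := [set t | e <= t])) => [y _|];
    [exact: chv | exact: closed_ge].
rewrite [X in _ `<=` X](closure_id _).1 //; apply: closure_subset => z /=.
apply: contra_neqP => /negP; rewrite -ltNge => hz.
by rewrite max_r // subr_le0 ltW.
Qed.

(** This provides a nonnegative element of [H] uniformly close to the positive part of [h]: totality
    gives a sequence decreasing to the truncation, and Dini makes the approximation uniform. *)
Lemma truncation_approx (h : X -> R) (e : R) :
  total_outside_zeros H -> H h -> 0 < e ->
  exists2 p, H p & forall y,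
    Num.max (h y - e) 0 <= p y <= Num.max (h y - e) 0 + e.
Proof.
move=> tot Hh e0; have ch : continuous h by case: HC => + _ _; exact.
have [k Hk] := tot _ (truncation_Cc Hh e0).
set g := (EFin \o _) => kg.
(* The extension by zero agrees with the truncation on all of [X]: where [h] vanishes,
   [Num.max (- e) 0] is [0]. *)
have gE y : g y = (Num.max (h y - e) 0)%:E.
  have phiE : (fun z : ~` zeros H => Num.max (h (\val z) - e) 0) =
      sigL (~` zeros H) (fun z => Num.max (h z - e) 0).
    by rewrite /sigL set_valE.
  have -> : g y = (patch (fun=> 0) (~` zeros H) (fun z => Num.max (h z - e) 0) y)%:E.
    rewrite /g phiE; congr (_%:E).
    exact: (congr1 (fun r => r (fun z => Num.max (h z - e) 0) y) (sigLK 0)).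
  rewrite patchE; case: ifPn => // /negP; rewrite inE /= => /contrapT/(_ _ Hh) ->.
  by rewrite max_r // sub0r oppr_le0 ltW.
have cg : continuous (fun y => Num.max (h y - e) 0 + e).
  move=> y; apply: cvgD; last exact: cvg_cst.
  apply: (@continuous_max _ _ (fun y => h y - e) (cst 0)); last exact: cvg_cst.
  exact: (continuousB ch (@cst_continuous _ _ e)).
have ck i : continuous (k i) by case: HC => + _ _; apply.
have [|i ki] := dini_decreases_to cX ck kg cg.
  by move=> y; rewrite gE lte_fin ltrDl.
exists (k i) => // y; apply/andP; split; last exact: ltW.
by rewrite -lee_fin -gE; exact: decreases_to_ge.
Qed.

End truncation.

(** * The functional attached to an increasing sequence *)

Section duality.
Context {R : realType} {X : metricType R}.
Variables (H : set (X -> R)) (F : set (X -> \bar R)) (x : X) (C : R).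
Hypotheses (cX : compact [set: X]) (HC : subspace_of_C H).
Hypotheses (tot : total_outside_zeros H) (Fcone : usc_cone F).
Hypothesis adm : admissible H F.
Hypothesis C0 : 0 < C.
Hypothesis minorant : forall h, H h -> exists u,
  [/\ F u, forall y, (u y <= (h y)%:E)%E & ((- C * sup_norm h)%:E <= u x)%E].

Let Hcont h : H h -> continuous h.
Proof. by case: HC => + _ _; exact. Qed.

Let HD f g : H f -> H g -> H (f \+ g).
Proof.
move=> Hf Hg; by case: HC => _ _ /(_ 1 f g Hf Hg); rewrite scale1r.
Qed.

Let HZ a f : H f -> H (fun y => a * f y).
Proof.
move=> Hf; by case: HC => _ H0 /(_ a f 0 Hf H0); rewrite addr0.
Qed.

Let HN f : H f -> H (fun y => - f y).
Proof. by move=> /(HZ (-1)); congr H; apply/funext => y; rewrite mulN1r. Qed.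

Let HB f g : H f -> H g -> H (fun y => f y - g y).
Proof. by move=> Hf Hg; exact: HD Hf (HN Hg). Qed.

Let minorant_bound h (M : R) : H h -> (forall y, `|h y| <= M) ->
  exists u, [/\ F u, forall y, (u y <= (h y)%:E)%E & ((- (C * M))%:E <= u x)%E].
Proof.
move=> Hh hM; have [u [Fu uh ux]] := minorant Hh; exists u; split=> //.
apply: le_trans ux; rewrite lee_fin mulNr lerN2 ler_pM2l //.
exact: (sup_norm_le x).
Qed.

Let FD u v : F u -> F v -> F (fun y => u y + v y)%E.
Proof. by case: Fcone => _ + _; apply. Qed.

(** This minorant of [0] stands in for the zero function, which [F] need not contain. *)
Lemma minorant0 : exists u, [/\ F u, forall y, (u y <= 0)%E & u x = 0%E].
Proof.
have H0 : H (cst 0) by case: HC.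
have [|u [Fu u0 ux]] := minorant_bound (M := 0) H0; first by move=> y; rewrite normr0.
exists u; split=> //; apply/eqP; rewrite eq_le u0 /=.
by move: ux; rewrite mulr0 oppr0.
Qed.

(* With [p] and [q] close to the positive and negative parts of [h], add up
   minorants of [p >= 0], of [- q], of norm about [b], and of the small
   remainder [h - p + q]. *)
Lemma minorant_of_lower_bound h (b e : R) :
  H h -> 0 <= b -> (forall y, - b <= h y) -> 0 < e -> exists u,
    [/\ F u, forall y, (u y <= (h y)%:E)%E & ((- (C * b) - e)%:E <= u x)%E].
Proof.
(* The minorant of [- q] loses [C * d] beyond [C * b] and that of the remainder loses [C * (2 * d)],
   hence the factor [3]. *)
move=> Hh b0 hb e0; pose d := e / (C * 3).
have d0 : 0 < d by rewrite divr_gt0 // mulr_gt0.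
have [p Hp pE] := truncation_approx cX HC tot Hh d0.
have [q Hq qE] := truncation_approx cX HC tot (HN Hh) d0.
have pq y : [/\ 0 <= p y, 0 <= q y <= b + d & `|h y - p y + q y| <= 2 * d].
  have := pE y; have := qE y; have := hb y.
  rewrite ler_norml; case: (leP (h y - d) 0); case: (leP (- h y - d) 0);
    by move=> *; split; [lra | apply/andP; split; lra | apply/andP; split; lra].
have [u0 [Fu0 u00 u0x]] := minorant0.
have [u1 [Fu1 u1q u1x]] : exists u,
    [/\ F u, forall y, (u y <= (- q y)%:E)%E & ((- (C * (b + d)))%:E <= u x)%E].
  apply: minorant_bound => [|y]; first exact: HN.
  by rewrite normrN ger0_norm; have [_ /andP[]] := pq y.
have [u2 [Fu2 u2r u2x]] : exists u,
    [/\ F u, forall y, (u y <= (h y - p y + q y)%:E)%E & ((- (C * (2 * d)))%:E <= u x)%E].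
  apply: minorant_bound => [|y]; first by apply: HD => //; exact: HB.
  by have [] := pq y.
exists (fun y => u0 y + u1 y + u2 y)%E; split.
- by apply: FD => //; exact: FD.
- move=> y; have [p0 _ _] := pq y.
  have -> : h y = 0 - q y + (h y - p y + q y) + p y by ring.
  apply: (@le_trans _ _ (0 - q y + (h y - p y + q y))%:E); last first.
    by rewrite lee_fin lerDl.
  by rewrite !EFinD; apply: leeD (u2r y); apply: leeD (u00 y) (u1q y).
- have -> : - (C * b) - e = 0 + - (C * (b + d)) + - (C * (2 * d)).
    by rewrite /d; field; rewrite gt_eqF.
  by rewrite !EFinD; apply: leeD u2x; apply: leeD u1x; rewrite u0x.
Qed.

(** Take [g i] in [H] with [u <= g i < k + a + d]. Then [k - g i] is in [H] and at least
    [- (a + d)], and adding to [u] a minorant of it gives a function below [k]. *)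
Lemma minorant_of_shift u k (a r e : R) : F u -> H k -> 0 <= a ->
  (forall y, u y <= (k y + a)%:E)%E -> (r%:E <= u x)%E -> 0 < e ->
  exists w, [/\ F w, forall y, (w y <= (k y)%:E)%E &
    ((r - C * a - e)%:E <= w x)%E].
Proof.
move=> Fu Hk a0 uk rux e0; pose d := e / (2 * C).
have d0 : 0 < d by rewrite divr_gt0 // mulr_gt0.
have [g Hg gu] := adm.2 u Fu.
have cf : continuous (fun y => k y + (a + d)).
  by move=> y; apply: cvgD; [exact: Hcont | exact: cvg_cst].
have [i|y|i gi] := dini_decreases_to cX _ gu cf; first exact: Hcont.
  by apply: le_lt_trans (uk y) _; rewrite lte_fin addrA ltrDl.
have e2 : 0 < e / 2 by lra.
have ad : 0 <= a + d by lra.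
have kg y : - (a + d) <= k y - g i y by have := gi y; lra.
have [v [Fv vk vx]] := minorant_of_lower_bound (HB Hk (Hg i)) ad kg e2.
exists (fun y => u y + v y)%E; split; first exact: FD.
- move=> y; have -> : k y = g i y + (k y - g i y) by ring.
  by rewrite EFinD; apply: leeD (vk y); exact: decreases_to_ge.
- have -> : r - C * a - e = r + (- (C * (a + d)) - e / 2).
    by rewrite /d; field; rewrite gt_eqF.
  by rewrite EFinD; exact: leeD.
Qed.

Variables (h : (X -> R)^nat) (s : R).
Hypotheses (Hh : forall i, H (h i)) (ndh : forall y, nondecreasing_seq (h^~ y)).
Hypothesis h_le_s : forall i u, F u -> (forall y, u y <= (h i y)%:E)%E ->
  (u x <= s%:E)%E.

(* Membership of [(g, c)] forces [c <= \int g dmu] for every Jensen measure [mu]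
   of mass at most [C] such that [\int h_j dmu <= s] for all [j]. *)
Definition jensen_cone : set ((X -> R) * R) :=
  [set p | exists u t j a, [/\ F u, 0 <= t, 0 <= a,
    forall y, (u y <= (p.1 y + t * h j y + a)%:E)%E &
    ((p.2 + t * s + C * a)%:E <= u x)%E]].

(** For consistency, [u <= t * h j + a] is turned by [minorant_of_shift] into some [w <= t * h j]
    with [w x >= c + t * s - e]; since [w x <= t * s] by the choice of [s], [c <= e] follows. *)
Lemma jensen_cone_proper : proper_cone jensen_cone.
Proof.
split.
- move=> g g' c c' [u [t [j [a [Fu t0 a0 ug cu]]]]].
  move=> [v [t' [j' [a' [Fv t'0 a'0 vg cv]]]]].
  (* As [h] is nondecreasing, both constraints can be weakened to the common index [maxn j j']. *)
  exists (fun y => u y + v y)%E, (t + t'), (maxn j j'), (a + a').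
  rewrite !addr_ge0 //=; split=> [|//|//|y|]; first exact: FD.
    apply: le_trans (leeD (ug y) (vg y)) _; rewrite -EFinD lee_fin /=.
    have : t * h j y <= t * h (maxn j j') y.
      by rewrite ler_wpM2l // ndh // leq_maxl.
    have : t' * h j' y <= t' * h (maxn j j') y.
      by rewrite ler_wpM2l // ndh // leq_maxr.
    rewrite mulrDl; change ((g + g') y) with (g y + g' y); lra.
  by apply: le_trans (leeD cu cv); rewrite -EFinD lee_fin /=; lra.
- move=> r g c r0 [u [t [j [a [Fu t0 a0 ug cu]]]]].
  exists (fun y => r%:E * u y)%E, (r * t), j, (r * a).
  split=> [|||y|]; rewrite ?mulr_ge0 ?(ltW r0) //.
  - by case: Fcone => _ _; apply.
  - apply: (@le_trans _ _ (r%:E * (g y + t * h j y + a)%:E)%E).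
      by rewrite lee_pmul2l // lte_fin.
    rewrite -EFinM lee_fin /= !mulrDr mulrA.
    by change ((r *: g) y) with (r * g y).
  - apply: (@le_trans _ _ (r%:E * (c + t * s + C * a)%:E)%E).
      by rewrite -EFinM lee_fin /=; lra.
    by rewrite lee_pmul2l // lte_fin.
- move=> c [u [t [j [a [Fu t0 a0 ug cu]]]]].
  apply/ler_addgt0Pr => e e0.
  have ug' y : (u y <= (t * h j y + a)%:E)%E.
    by have := ug y; rewrite /= add0r.
  have [w [Fw wh wx]] := minorant_of_shift Fu (HZ t (Hh j)) a0 ug' cu e0.
  suff : (w x <= (t * s)%:E)%E by move=> /(le_trans wx); rewrite lee_fin /=; lra.
  (* For [t = 0] the bound is [w x <= 0]; for [t > 0] the function [w / t] is a minorant of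
     [h j]. *)
  move: t0; rewrite le_eqVlt => /predU1P[t0|t0].
    by have := wh x; rewrite -t0 !mul0r.
  have ti : 0 < t^-1 by rewrite invr_gt0.
  have : (t^-1%:E * w x <= s%:E)%E.
    apply: (h_le_s (i := j) (u := fun y => (t^-1)%:E * w y)%E).
      by case: Fcone => _ _; apply.
    move=> y; rewrite -(lee_pmul2l _ (_ : 0 < t%:E)%E) ?lte_fin // muleA -!EFinM.
    by rewrite divff ?gt_eqF // mul1e.
  rewrite -(lee_pmul2l _ (_ : 0 < t%:E)%E) ?lte_fin // muleA -!EFinM.
  by rewrite divff ?gt_eqF // mul1e.
Qed.

Lemma jensen_functional : exists L : positive_functional R X,
  (forall i, L (h i) <= s) /\
  forall g u r, H g -> F u -> (forall y, u y <= (g y)%:E)%E ->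
    (r%:E <= u x)%E -> r <= L g.
Proof.
have [u0 [Fu0 u00 u0x]] := minorant0.
(* These constraints give every continuous function a lower bound, as [sandwich] requires, and with
   [b = 0] they make [L] positive. *)
have cone_bound (g : X -> R) (b : R) :
      0 <= b -> (forall y, - b <= g y) -> jensen_cone (g, - (C * b)).
  move=> b0 gb; exists u0, 0, 0%N, b; split=> //= [y|]; last first.
    by rewrite u0x mul0r addr0 lee_fin; lra.
  by apply: le_trans (u00 y) _; rewrite lee_fin mul0r addr0; have := gb y; lra.
have [|||||L [LD LZ LP]] := @sandwich R (X -> R) jensen_cone [set g | continuous g].
- exact: jensen_cone_proper.
- by have := cone_bound (0 : X -> R) 0; rewrite mulr0 oppr0; apply.
- exact: cst_continuous.
- move=> a f g cf cg y; apply: cvgD; last exact: cg.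
  by apply: cvgZr; exact: cf.
- move=> g cg; have [M [M0 bM]] := bounded_continuous cX cg.
  exists (- (C * M)); apply: cone_bound => // y.
  by have := bM y; rewrite ler_norml => /andP[].
have L_ge0 (f : X -> R) : continuous f -> (forall y, 0 <= f y) -> 0 <= L f.
  move=> cf f0; rewrite -[leLHS]oppr0 -(mulr0 C); apply: LP => //.
  by apply: cone_bound => // y; rewrite oppr0.
exists (@Build_positive_functional R X L LD LZ L_ge0); split=> [i|g u r Hg Fu ug ru].
  rewrite -[leLHS]opprK -[leRHS]opprK lerN2 -pfunN; last exact/Hcont.
  apply: LP; first exact/continuousN/Hcont.
  (* The constraint [(- h i, - s)], with [t = 1] and [j = i], amounts to [L (h i) <= s]. *)
  exists u0, 1, i, 0; split=> //= [y|].
    by rewrite mul1r addNr addr0.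
  by rewrite u0x mul1r addNr mulr0 addr0.
apply: LP; first exact: Hcont.
exists u, 0, 0%N, 0; split=> //= [y|].
  by rewrite mul0r !addr0.
by rewrite mul0r mulr0 !addr0.
Qed.

End duality.

(** * Integrals of monotone limits *)

Section monotone_integrals.
Context {R : realType} {X : topologicalType} {x : X}.
Variable mu : {finite_measure set (borel x) -> \bar R}.
Hypothesis cX : compact [set: X].
Implicit Types (h : (X -> R)^nat) (g u : X -> \bar R) (s : R).
Local Open Scope ereal_scope.

Lemma increases_to_measurable h g : (forall i, continuous (h i)) ->
  increases_to h g -> measurable_fun setT (g : borel x -> \bar R).
Proof.
move=> ch hg.
apply: (emeasurable_fun_cvg (fun i => EFin \o (h i) : borel x -> \bar R)) => [i|y _].
  by apply/measurable_EFinP; exact: continuous_borel_measurable.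
by have [_] := hg y.
Qed.

(** Adding a bound [M] of [h 0] makes the sequence nonnegative, so monotone convergence applies; [M]
    is then subtracted, the measure being finite. *)
Lemma increases_to_integral_le h g s : (forall i, continuous (h i)) ->
  increases_to h g -> (forall i, \int[mu]_y (h i y)%:E <= s%:E) ->
  mu.-integrable setT (g : borel x -> \bar R) /\ \int[mu]_y g y <= s%:E.
Proof.
move=> ch hg hs; have [M [M0 bM]] := bounded_continuous cX (ch 0%N).
have hM i y : (0 <= h i y + M)%R.
  have [nd _] := hg y; have := nd _ _ (leq0n i); have := bM y.
  by rewrite ler_norml => /andP[]; lra.
have mM : mu.-integrable setT (EFin \o cst M : borel x -> \bar R).
  exact: finite_measure_integrable_cst.
pose G (y : borel x) := g y + M%:E.
have hG y : (h i y + M)%:E @[i --> \oo] --> G y.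
  under eq_fun do rewrite EFinD.
  by apply: cvgeD; [rewrite fin_num_adde_defl | have [] := hg y | exact: cvg_cst].
have G0 y : 0 <= G y.
  apply: (@le_trans _ _ ((h 0%N y + M)%:E)); first by rewrite lee_fin.
  by rewrite EFinD leeD2r // increases_to_le.
have mh i : measurable_fun setT (EFin \o (fun y => h i y + M)%R : borel x -> \bar R).
  apply/measurable_EFinP; apply: continuous_borel_measurable.
  by move=> y; apply: cvgD; [exact: ch | exact: cvg_cst].
have mG : measurable_fun setT G.
  exact: (emeasurable_fun_cvg _ _ mh (fun y _ => hG y)).
have finM := integrable_fin_num _ mM.
have intG : \int[mu]_y G y <= s%:E + \int[mu]_y M%:E.
  have GE : G = (fun y => limn (fun i => (h i y + M)%:E)).
    by apply/funext => y; apply/esym/cvg_lim.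
  have nd (y : borel x) : setT y -> nondecreasing_seq (fun i => (h i y + M)%:E).
    by move=> _ i j ij; rewrite lee_fin lerD2r; have [+ _] := hg y; exact.
  have := @cvg_monotone_convergence _ _ _ mu setT measurableT
    (fun i y => (h i y + M)%:E) mh (fun i y _ => hM i y) nd.
  rewrite -GE => cvG; rewrite -(cvg_lim _ cvG) //.
  apply: lime_le; first by apply/cvg_ex; eexists; exact: cvG.
  apply: nearW => i; rewrite integralD_EFin //; first exact: leeD2r (hs i).
  exact: continuous_integrable.
have iG : mu.-integrable setT G.
  apply/integrableP; split=> //.
  under eq_integral do rewrite gee0_abs //.
  by apply: le_lt_trans intG _; rewrite ltey_eq fin_numD finM.
have gE : g = G \- cst M%:E.
  by apply/funext => y; rewrite /G /= addeK.
rewrite gE; split; first exact: integrableB.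
by rewrite integralB // leeBlDr ?finM //; exact: intG.
Qed.

Lemma decreases_to_integral_ge h u s : (forall i, continuous (h i)) ->
  decreases_to h u -> (forall i, s%:E <= \int[mu]_y (h i y)%:E) ->
  s%:E <= \int[mu]_y u y.
Proof.
move=> ch hu hs; have chN i : continuous (fun y => - h i y)%R by exact: continuousN.
have [|iu us] := increases_to_integral_le (s := (- s)%R) chN (decreases_toN hu).
  move=> i; under eq_integral do rewrite EFinN.
  rewrite integralN; first by rewrite EFinN leeN2.
  exact/integrable_add_def/continuous_integrable.
rewrite -leeN2; under [in X in X <= _]eq_integral do rewrite -[u _]oppeK.
by rewrite integralN ?oppeK //; exact: integrable_add_def.
Qed.

(** Values and integrals may be infinite, so the comparison is made separately on positive and
    negative parts. *)
Lemma le_integral_limits h k u g : (forall i, continuous (h i)) ->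
  (forall i, continuous (k i)) -> increases_to h g -> decreases_to k u ->
  (forall y, u y <= g y) -> \int[mu]_y u y <= \int[mu]_y g y.
Proof.
move=> ch ck hg ku ug.
have mg := increases_to_measurable ch hg.
have mu_ : measurable_fun setT (u : borel x -> \bar R).
  apply: (emeasurable_fun_cvg (fun i => EFin \o (k i) : borel x -> \bar R)) => [i|y _].
    by apply/measurable_EFinP; exact: continuous_borel_measurable.
  by have [_] := ku y.
rewrite integralE [leRHS]integralE leeB //; apply: ge0_le_integral => //.
- exact: measurable_funepos.
- exact: measurable_funepos.
- by move=> y _; apply: (@funepos_le _ _ setT) => //; rewrite inE.
- exact: measurable_funeneg.
- exact: measurable_funeneg.
- by move=> y _; apply: (@funeneg_le _ _ setT) => //; rewrite inE.
Qed.

End monotone_integrals.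

(** * Equality of the two envelopes on increasing limits *)

Theorem theorem2p4 (R : realType) (X : metricType R)
    (H : set (X -> R)) (F : set (X -> \bar R)) (x : X) :
  compact [set: X] ->
  subspace_of_C H -> total_outside_zeros H ->
  usc_cone F -> admissible H F ->
  (exists2 C : R, 0 < C & forall h, H h ->
     exists u, [/\ F u, forall y, (u y <= (h y)%:E)%E &
                   ((- C * sup_norm h)%:E <= u x)%E]) ->
  forall (h : (X -> R)^nat) (h_oo : X -> \bar R),
    (forall i, H (h i)) -> increases_to h h_oo ->
    S_ F x h_oo = I_ F x h_oo.
Proof.
move=> cX HC tot Fcone adm [C C0 minorant] h h_oo Hh hoo.
have Hcont g : H g -> continuous g by case: HC => + _ _; exact.
apply/eqP; rewrite eq_le; apply/andP; split.
  apply: ge_ereal_sup => _ [u [Fu uh] <-].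
  apply: le_ereal_inf_tmp => _ [mu [_ muF] <-].
  (* Admissibility makes [u] a limit of continuous functions, hence Borel. *)
  have [k Hk ku] := adm.2 u Fu.
  apply: le_trans (muF _ Fu) _.
  by apply: le_integral_limits hoo ku uh => // i; exact: Hcont.
have [->|Soo] := eqVneq (S_ F x h_oo) +oo%E; first exact: leey.
have S_ge u : F u -> (forall y, u y <= h_oo y)%E -> (u x <= S_ F x h_oo)%E.
  by move=> Fu uh; apply: ereal_sup_ubound; exists u.
have hle i y : ((h i y)%:E <= h_oo y)%E by exact: increases_to_le.
(* The minorant of [h 0] given by the hypothesis on [C] excludes the value [-oo]. *)
have Sfin : S_ F x h_oo \is a fin_num.
  rewrite fin_numE Soo andbT.
  have [u [Fu uh ux]] := minorant _ (Hh 0%N).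
  have : (u x <= S_ F x h_oo)%E.
    by apply: S_ge => // y; exact: le_trans (uh y) (hle 0%N y).
  by apply: contraTneq => ->; rewrite -ltNge (lt_le_trans _ ux) ?ltNyr.
have [||L [Lh LF]] := @jensen_functional R X H F x C cX HC tot Fcone adm C0
    minorant h (fine (S_ F x h_oo)) Hh.
- by move=> y; have [] := hoo y.
- move=> i u Fu uh; rewrite fineK //; apply: S_ge => // y.
  exact: le_trans (uh y) (hle i y).
have Lint g : H g -> (\int[riesz_measure L x]_y (g y)%:E = (L g)%:E)%E.
  by move=> Hg; apply: riesz_integral => //; exact: Hcont.
rewrite -[leRHS]fineK //.
apply: (@le_trans _ _ (\int[riesz_measure L x]_y h_oo y)%E); last first.
  have [||] := @increases_to_integral_le _ _ _ (riesz_measure L x) cX h h_oo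
    (fine (S_ F x h_oo)) _ hoo => //.
    by move=> i; exact: Hcont.
  by move=> i; rewrite Lint // lee_fin.
apply: ereal_inf_lbound; exists (riesz_measure L x) => //; split.
  by exists setT => //; rewrite setCT measure0.
(* The Jensen inequality for [u] is the limit of [u x <= L (k i)], where [k i] in [H] decreases to
   [u]. *)
move=> u Fu; have [k Hk ku] := adm.2 u Fu.
have [uNoo|uNoo] := eqVneq (u x) -oo%E; first by rewrite uNoo leNye.
have uxfin : u x \is a fin_num.
  by rewrite fin_numE uNoo /= lt_eqF //; case: Fcone => /(_ _ Fu)[+ _] _ _; apply.
rewrite -(fineK uxfin).
apply: (decreases_to_integral_ge cX _ ku) => i; first exact: Hcont.
rewrite Lint // lee_fin; apply: LF Fu _ _ => // [y|]; last by rewrite fineK.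
exact: decreases_to_ge.
Qed.
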